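(* Let $F$ be a minimally unsatisfiable clause-set which is eventually saturated, i.e., every element of $\mathrm{sDP}(F)$ is saturated. Then singular DP-reduction is confluent modulo isomorphism on $F$: any two elements $F', F'' \in \mathrm{sDP}(F)$ are isomorphic.
   Context: Literals are variables $v$ and complements $\overline{v}$; a clause is a finite set of literals with no complementary pair; a clause-set is a finite set of clauses; $\mathrm{var}(F)$ is the set of variables of $F$; $\mathrm{ldeg}_F(x)$ is the number of clauses of $F$ containing literal $x$. $\mathrm{DP}_v(F) := \{C \in F : v \notin \mathrm{var}(C)\} \cup \{(C \cup D)\setminus\{v,\overline{v}\} : C, D \in F,\ C \cap \overline{D} = \{v\}\}$. $\mathrm{MU}$ is the set of minimally unsatisfiable clause-sets. $F\in\mathrm{MU}$ is saturated if for every $C \in F$ and every literal $x$ with $\mathrm{var}(x) \in \mathrm{var}(F)\setminus \mathrm{var}(C)$, the clause-set $(F\setminus\{C\})\cup\{C\cup\{x\}\}$ is satisfiable. A variable $v$ is singular for $F$ if $\min(\mathrm{ldeg}_F(v),\mathrm{ldeg}_F(\overline{v}))=1$; $F$ is nonsingular if it has none. A singular DP-reduction step is $F\leadsto \mathrm{DP}_v(F)$ for $F\in\mathrm{MU}$ and $v$ singular for $F$. $\mathrm{sDP}(F)$ is the set of nonsingular $F'\in\mathrm{MU}$ obtainable from $F$ by zero or more singular DP-reduction steps. Clause-sets $F,G$ are isomorphic if there is a bijection on literals commuting with complementation that maps the clauses of $F$ exactly onto the clauses of $G$. *)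

(* Defs.v *)
From HB Require Import structures.
From mathcomp Require Import all_boot all_order.
From mathcomp Require Import finmap.
Set Implicit Arguments. Unset Strict Implicit. Unset Printing Implicit Defensive.
Local Open Scope fset_scope.

Definition lit := (nat * bool)%type.
Definition litvar (x : lit) : nat := x.1.
Definition compl (x : lit) : lit := (x.1, ~~ x.2).
Definition posl (v : nat) : lit := (v, true).
Definition negl (v : nat) : lit := (v, false).

Definition clause := {fset lit}.
Definition clauseset := {fset clause}.

Definition is_clause (C : clause) : bool := [forall x : C, compl (val x) \notin C].
Definition is_clauseset (F : clauseset) : bool := [forall C : F, is_clause (val C)].

Definition complcl (C : clause) : clause := compl @` C.
Definition varcl (C : clause) : {fset nat} := litvar @` C.
Definition varcs (F : clauseset) : {fset nat} := \bigcup_(C <- F) varcl C.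

Definition ldeg (F : clauseset) (x : lit) : nat := #|` [fset C in F | x \in C]|.

Definition DP (v : nat) (F : clauseset) : clauseset :=
  [fset C in F | v \notin varcl C] `|`
  [fset (C `|` D) `\` [fset posl v; negl v] | C in F, D in F
     & (C `&` complcl D) == [fset posl v]].

Definition satisfies (f : nat -> bool) (F : clauseset) : Prop :=
  forall C, C \in F -> exists2 x, x \in C & f (litvar x) = x.2.
Definition satisfiable (F : clauseset) : Prop := exists f, satisfies f F.

Definition MU (F : clauseset) : Prop :=
  ~ satisfiable F /\ forall C, C \in F -> satisfiable (F `\ C).

Definition saturated (F : clauseset) : Prop :=
  MU F /\
  forall C (x : lit), C \in F -> litvar x \in varcs F -> litvar x \notin varcl C ->
    satisfiable ((F `\ C) `|` [fset C `|` [fset x]]).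

Definition singular (F : clauseset) (v : nat) : Prop :=
  minn (ldeg F (posl v)) (ldeg F (negl v)) = 1%N.
Definition nonsingular (F : clauseset) : Prop := forall v, ~ singular F v.

Definition sDP_step (F G : clauseset) : Prop :=
  MU F /\ exists v, singular F v /\ G = DP v F.

Inductive sDP_star : clauseset -> clauseset -> Prop :=
| sDP_refl F : sDP_star F F
| sDP_cons F G H : sDP_step F G -> sDP_star G H -> sDP_star F H.

Definition in_sDP (F F' : clauseset) : Prop :=
  sDP_star F F' /\ nonsingular F' /\ MU F'.

Definition isomorphic (F G : clauseset) : Prop :=
  exists g : lit -> lit,
    bijective g /\ (forall x, g (compl x) = compl (g x)) /\
    (fun C : clause => g @` C) @` F = G.

(* Main.v *)
(** If the literal [x] occurs in the minimally unsatisfiable [F] only in the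
    clause [C], then [DP (litvar x) F] is the injective image of [F `\ C] under
    [M |-> (C `|` M) `\` [fset x; compl x]] (for [M] containing [compl x]) and
    the identity elsewhere.  Two singular reductions commute whenever each
    leaves the other variable singular.  The only obstruction is a clash: [x]
    and [y] both occur only in one clause [C], while [compl x] and [compl y]
    occur at least twice.  If some third variable is singular after one of the
    clashing reductions, then it commutes with both of them, and induction on
    the number of variables applies.  Otherwise both reducts are nonsingular,
    hence saturated; saturation forces the rest of [C] into every clause
    containing [compl x] or [compl y], and then renaming [y] to [compl x] (and
    [compl y] to [x]) maps one reduct onto the other. *)
Require Import Defs.
From HB Require Import structures.
From mathcomp Require Import all_boot all_order.
From mathcomp Require Import finmap.
Set Implicit Arguments. Unset Strict Implicit. Unset Printing Implicit Defensive.
Local Open Scope fset_scope.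

(** * Literals, complements and occurrences of variables *)

Lemma complK : involutive compl.
Proof. by case=> v b; rewrite /compl /= negbK. Qed.

Lemma litvar_compl x : litvar (compl x) = litvar x.
Proof. by []. Qed.

Lemma compl_neq x : compl x != x.
Proof. by case: x => v []; rewrite /compl xpair_eqE /= andbF. Qed.

Lemma litvar_eq x y : litvar x = litvar y -> x = y \/ x = compl y.
Proof.
case: x y => v b [w c] /= ->.
by case: b c => -[]; rewrite /compl /=; auto.
Qed.

Lemma in_complcl x (C : clause) : (x \in complcl C) = (compl x \in C).
Proof.
apply/imfsetP/idP => /= [[y yC ->]|xC]; first by rewrite complK.
by exists (compl x); rewrite ?complK.
Qed.

Lemma varclP v (C : clause) :
  reflect (exists2 x, x \in C & litvar x = v) (v \in varcl C).
Proof.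
apply: (iffP idP) => [/imfsetP [x xC ->]|[x xC e]]; first by exists x.
by apply/imfsetP; exists x.
Qed.

Lemma notin_varcl x (C : clause) :
  (litvar x \notin varcl C) = (x \notin C) && (compl x \notin C).
Proof.
rewrite -negb_or; congr (~~ _); apply/varclP/orP.
  by move=> [y yC /litvar_eq [<-|<-]]; auto.
by case=> xC; [exists x | exists (compl x)].
Qed.

Lemma varcsP v (F : clauseset) :
  reflect (exists2 C, C \in F & v \in varcl C) (v \in varcs F).
Proof.
apply: (iffP idP) => [/bigfcupP [C /andP[CF _] vC]|[C CF vC]]; first by exists C.
by apply/bigfcupP; exists C; rewrite ?CF.
Qed.

(** [DP] is defined with the positive literal on the left; exchanging the two parents turns a
    conflict at [x] into one at [compl x], so either sign may be used. *)
Lemma in_DP x (F : clauseset) (A : clause) :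
  A \in DP (litvar x) F <->
  (A \in F /\ litvar x \notin varcl A) \/
  (exists C D, [/\ C \in F, D \in F, C `&` complcl D = [fset x] &
                   A = (C `|` D) `\` [fset x; compl x]]).
Proof.
have swap (C D : clause) y :
    C `&` complcl D = [fset y] -> D `&` complcl C = [fset compl y].
  move=> /fsetP e; apply/fsetP => z; move: (e (compl z)).
  rewrite !inE !in_complcl complK andbC => ->.
  by rewrite -(inj_eq (inv_inj complK)) complK.
rewrite /DP in_fsetU; case: x => v b /=; split.
  case/orP => [|/imfset2P [/= C CF [D]]].
    by rewrite !inE /= => /andP[-> ->]; left.
  rewrite !inE /= => /andP[DF /eqP e] ->; right.
  case: b; first by exists C, D; split.
  exists D, C; split => //; first exact: (swap _ _ _ e).
  by rewrite fsetUC; congr (_ `\` _); apply: fsetUC.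
case=> [[AF vA]|[C [D [CF DF e ->]]]]; apply/orP.
  by left; rewrite !inE /= AF.
right; apply/imfset2P => /=.
case: b e => e.
  by exists C => //; exists D => //; rewrite !inE /= DF; apply/eqP.
exists D => //; exists C; last by rewrite fsetUC; congr (_ `\` _); apply: fsetUC.
by rewrite !inE /= CF; apply/eqP; apply: (swap _ _ _ e).
Qed.

Lemma varcs_DP v F : varcs (DP v F) `<=` varcs F `\ v.
Proof.
apply/fsubsetP => u /varcsP [A].
rewrite -[v]/(litvar (posl v)) => /in_DP [[AF vA] uA|].
  rewrite !inE; apply/andP; split; last by apply/varcsP; exists A.
  by apply: contraNneq vA => <-.
move=> [C [D [CF DF _ ->]]] /varclP [z]; rewrite !inE negb_or -andbA.
move=> /and3P[zx zcx zCD] <-; apply/andP; split.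
  by apply/eqP => /litvar_eq [] e; [move: zx|move: zcx]; rewrite e eqxx.
by apply/varcsP; case/orP: zCD => zE; [exists C|exists D] => //;
  apply/varclP; exists z.
Qed.

(** * Assignments and minimal unsatisfiability *)

Definition lit_true (f : nat -> bool) (x : lit) : bool := f (litvar x) == x.2.

Lemma lit_true_compl f x : lit_true f (compl x) = ~~ lit_true f x.
Proof. by case: x => v b; rewrite /lit_true /=; case: (f v) b => -[]. Qed.

Lemma satisfiesP f F :
  satisfies f F <-> forall C, C \in F -> exists2 x, x \in C & lit_true f x.
Proof.
by split=> h C /h [x xC e]; exists x => //; apply/eqP.
Qed.

Definition set_true (f : nat -> bool) (x : lit) : nat -> bool :=
  fun n => if n == litvar x then x.2 else f n.

Lemma set_trueE f x : lit_true (set_true f x) x.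
Proof. by rewrite /lit_true /set_true eqxx. Qed.

Lemma set_true_keep f x z :
  lit_true f z -> z != compl x -> lit_true (set_true f x) z.
Proof.
move=> fz zx; rewrite /lit_true /set_true.
have [/litvar_eq [->|e]|//] := eqVneq (litvar z) (litvar x).
  exact: eqxx.
by rewrite e eqxx in zx.
Qed.

Lemma MU_crit F M : MU F -> M \in F ->
  exists2 f, satisfies f (F `\ M) & forall z, z \in M -> ~~ lit_true f z.
Proof.
move=> [unsat crit] MF; have [f fM] := crit _ MF; exists f => // z zM.
apply/negP => fz; apply: unsat; exists f; apply/satisfiesP => K KF.
have [->|KM] := eqVneq K M; first by exists z.
by apply: (proj1 (satisfiesP _ _) fM); rewrite !inE KM.
Qed.

(** By [MU_crit] some assignment falsifies the whole of [C], which is impossible for a complementary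
    pair. *)
Lemma MU_nontaut F C x : MU F -> C \in F -> x \in C -> compl x \notin C.
Proof.
move=> FMU CF xC; apply/negP => cxC.
have [f _ fC] := MU_crit FMU CF; move: (fC _ cxC) (fC _ xC).
by rewrite lit_true_compl negbK => ->.
Qed.

(** If [A] and [B] differed, an assignment falsifying only [B] would satisfy [A], hence a literal of
    [B]. *)
Lemma MU_antichain F A B : MU F -> A \in F -> B \in F -> A `<=` B -> A = B.
Proof.
move=> FMU AF BF /fsubsetP AB; apply/eqP/negPn/negP => nAB.
have [f /satisfiesP fB nfB] := MU_crit FMU BF.
have [|z zA fz] := fB A; first by rewrite !inE nAB.
by move: (nfB _ (AB _ zA)); rewrite fz.
Qed.

(** * Literals with a single occurrence, and singular variables *)

Definition main (F : clauseset) (x : lit) (C : clause) : Prop :=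
  [/\ C \in F, x \in C & forall M, M \in F -> x \in M -> M = C].

Lemma ldeg1P F x : reflect (exists C, main F x C) (ldeg F x == 1%N).
Proof.
rewrite /ldeg; apply: (iffP idP) => [/cardfs1P|] [C].
  move=> /fsetP e; exists C; move: (e C); rewrite !inE eqxx => /andP[CF xC].
  split=> // M MF xM; apply/eqP; move: (e M).
  by rewrite !inE /= MF xM => <-.
move=> [CF xC u]; apply/cardfs1P; exists C; apply/fsetP => M; rewrite !inE /=.
by apply/andP/eqP => [[]|->] //; apply: u.
Qed.

Lemma ldeg_gt0P (F : clauseset) x : reflect (exists2 C, C \in F & x \in C) (0 < ldeg F x)%N.
Proof.
rewrite cardfs_gt0; apply: (iffP idP) => [/fset0Pn|] [C].
  by rewrite !inE => /andP[]; exists C.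
by move=> CF xC; apply/fset0Pn; exists C; rewrite !inE /= CF.
Qed.

(** Replaces the minimum of two degrees by a choice of sign: [x] is a literal of degree one, and [D]
    shows that the degree of [compl x] is not zero. *)
Lemma singularP F v :
  singular F v <->
  exists x C D, [/\ litvar x = v, main F x C, D \in F & compl x \in D].
Proof.
rewrite /singular; split.
  move=> e; have [e1|e1] := leqP (ldeg F (posl v)) (ldeg F (negl v)).
    have h1 : ldeg F (posl v) = 1%N by rewrite -e; apply/esym/minn_idPl.
    have /ldeg1P [C CP] : ldeg F (posl v) == 1%N by apply/eqP.
    have /ldeg_gt0P [D DF vD] : (0 < ldeg F (negl v))%N by apply: leq_trans e1; rewrite h1.
    by exists (posl v), C, D.
  have h1 : ldeg F (negl v) = 1%N by rewrite -e; apply/esym/minn_idPr/ltnW.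
  have /ldeg1P [C CP] : ldeg F (negl v) == 1%N by apply/eqP.
  have /ldeg_gt0P [D DF vD] : (0 < ldeg F (posl v))%N by apply: leq_trans e1.
  by exists (negl v), C, D.
move=> [[u b] [C [D [/= -> CP DF cxD]]]].
have /eqP h1 : ldeg F (v, b) == 1%N by apply/ldeg1P; exists C.
have h2 : (0 < ldeg F (compl (v, b)))%N by apply/ldeg_gt0P; exists D.
by case: b h1 h2 {CP cxD}; rewrite /compl /= -/(posl v) -/(negl v) => -> h;
  [apply/minn_idPl|apply/minn_idPr].
Qed.

(** * Reduction at a literal with a single occurrence *)

Definition resolve_main (x : lit) (C M : clause) : clause :=
  if compl x \in M then (C `|` M) `\` [fset x; compl x] else M.

Lemma in_resolve_main x C M z : litvar z != litvar x ->
  (z \in resolve_main x C M) = (z \in M) || (compl x \in M) && (z \in C).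
Proof.
move=> zx; rewrite /resolve_main; case: ifP => _; last by rewrite orbF.
have zx1 : z != x by apply: contraNneq zx => ->.
have zx2 : z != compl x by apply: contraNneq zx => ->.
by rewrite !inE (negPf zx1) (negPf zx2) /= orbC.
Qed.

Section Main.
Variables (F : clauseset) (x : lit) (C : clause).
Hypotheses (FMU : MU F) (mainC : main F x C).

(** If a literal of [C] other than [x] were true, making [x] false would satisfy [M], keep [C]
    satisfied and hurt no other clause, as only [C] contains [x]; then [F] would be satisfiable. *)
Lemma main_crit M : M \in F -> compl x \in M ->
  exists f, [/\ satisfies f (F `\ M), forall z, z \in M -> ~~ lit_true f z &
                forall z, z \in C -> z != x -> ~~ lit_true f z].
Proof.
move=> MF cxM; have [f fM nfM] := MU_crit FMU MF.
exists f; split=> // z zC zx; apply/negP => fz.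
have [CF xC uC] := mainC; case: FMU => unsat _; apply: unsat.
exists (set_true f (compl x)); apply/satisfiesP => K KF.
have [->|KM] := eqVneq K M; first by exists (compl x); rewrite ?set_trueE.
have [->|KC] := eqVneq K C.
  by exists z => //; apply: set_true_keep => //; rewrite complK.
have [|k kK fk] := proj1 (satisfiesP _ _) fM K; first by rewrite !inE KM.
exists k => //; apply: set_true_keep => //; rewrite complK.
by apply: contraNneq KC => kx; apply/eqP/uC => //; rewrite -kx.
Qed.

(** The assignment of [main_crit] falsifies [M] and the rest of [C] together, so these cannot
    conflict. Hence every clause containing [compl x] can be resolved with [C] in the sense of
    [DP]. *)
Lemma main_conflict M z :
  M \in F -> compl x \in M -> z \in C -> compl z \in M -> z = x.
Proof.
move=> MF cxM zC czM; apply/eqP/negPn/negP => zx.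
have [f [_ nM nC]] := main_crit MF cxM.
by move: (nM _ czM) (nC _ zC zx); rewrite lit_true_compl negbK => ->.
Qed.

Lemma DP_main : DP (litvar x) F = [fset resolve_main x C M | M in F `\ C].
Proof.
have [CF xC uC] := mainC; have cxC := MU_nontaut FMU CF xC.
apply/fsetP => A; apply/idP/imfsetP => /=.
  move=> /in_DP [[AF]|[C1 [D [C1F DF /fsetP e ->]]]].
    rewrite notin_varcl => /andP[xA cxA]; exists A.
      by rewrite !inE AF andbT; apply: contraNneq xA => ->.
    by rewrite /resolve_main (negPf cxA).
  move: (e x); rewrite !inE eqxx in_complcl => /andP[xC1 cxD].
  exists D.
    by rewrite !inE DF andbT; apply: contraNneq cxC => <-.
  by rewrite /resolve_main cxD (uC C1).
move=> [M]; rewrite in_fsetD1 => /andP[MC MF] ->; rewrite /resolve_main.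
case: ifP => cxM; apply/in_DP; last first.
  left; split=> //; rewrite notin_varcl cxM andbT.
  by apply: contraNN MC => xM; apply/eqP/uC.
right; exists C, M; split=> //; apply/fsetP => z; rewrite !inE in_complcl.
apply/andP/eqP => [[zC czM]|->]; last by [].
exact: (main_conflict MF).
Qed.

Lemma in_DP_main M : M \in F -> M != C -> resolve_main x C M \in DP (litvar x) F.
Proof.
move=> MF MC; rewrite DP_main; apply/imfsetP; exists M => //=.
by rewrite !inE MC.
Qed.

Lemma DP_mainP A : A \in DP (litvar x) F ->
  exists M, [/\ M \in F, M != C & A = resolve_main x C M].
Proof.
rewrite DP_main => /imfsetP [M /=]; rewrite !inE => /andP[MC MF] ->.
by exists M.
Qed.

Lemma side_neq_main (M : clause) : compl x \in M -> M != C.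
Proof.
have [CF xC _] := mainC => cxM.
by apply: contraNneq (MU_nontaut FMU CF xC) => <-.
Qed.

Lemma notin_main M : M \in F -> M != C -> x \notin M.
Proof.
have [_ _ uC] := mainC => MF; apply: contraNN => xM.
by apply/eqP/uC.
Qed.

(** For [L] containing [compl x], the assignment of [main_crit] falsifies the image of [L]; any
    other [K] has a true literal that survives in its image, so the images differ. *)
Lemma resolve_main_inj M N : M \in F -> M != C -> N \in F -> N != C ->
  resolve_main x C M = resolve_main x C N -> M = N.
Proof.
suff side K L : K \in F -> K != C -> L \in F -> compl x \in L ->
    resolve_main x C K = resolve_main x C L -> K = L.
  move=> MF MC NF NC e.
  have [cxN|cxN] := boolP (compl x \in N); first exact: side.
  have [cxM|cxM] := boolP (compl x \in M); first exact/esym/side.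
  by move: e; rewrite /resolve_main (negPf cxN) (negPf cxM).
move=> KF KC LF cxL e; apply/eqP/negPn/negP => KL.
have [f [fL nfL nfC]] := main_crit LF cxL.
have [|k kK fk] := proj1 (satisfiesP _ _) fL K; first by rewrite !inE KL.
have kx : k != x by apply: contraNneq (notin_main KF KC) => <-.
have kcx : k != compl x by apply: contraTneq fk => ->; apply: nfL.
have : k \in resolve_main x C L.
  by rewrite -e /resolve_main; case: ifP => // _;
    rewrite !inE (negPf kx) (negPf kcx) kK orbT.
rewrite /resolve_main cxL !inE => /andP[_ /orP[kC|kL]].
  by move: (nfC _ kC kx); rewrite fk.
by move: (nfL _ kL); rewrite fk.
Qed.

Lemma MU_DP : MU (DP (litvar x) F).
Proof.
have [CF xC uC] := mainC; have cxC := MU_nontaut FMU CF xC.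
split.
  move=> [f /satisfiesP fDP]; case: FMU => unsat _; apply: unsat.
  have fM M : M \in F -> M != C ->
      exists2 k, k \in resolve_main x C M & lit_true f k.
    by move=> MF MC; apply/fDP/in_DP_main.
  (* A model of the reduct extends to [F]: if it satisfies [C] without [x], make [x] false;
     otherwise each true literal of a resolvent comes from the other parent, and [x] can be made
     true. *)
  have [/hasP [z zC /andP[zx fz]]|nC] :=
      boolP (has (fun z => (z != x) && lit_true f z) C).
    exists (set_true f (compl x)); apply/satisfiesP => K KF.
    have [->|KC] := eqVneq K C.
      by exists z => //; apply: set_true_keep => //; rewrite complK.
    have [cxK|cxK] := boolP (compl x \in K).
      by exists (compl x); rewrite ?set_trueE.
    have [k] := fM K KF KC; rewrite /resolve_main (negPf cxK) => kK fk.
    exists k => //; apply: set_true_keep => //; rewrite complK.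
    by apply: contraNneq (notin_main KF KC) => <-.
  exists (set_true f x); apply/satisfiesP => K KF.
  have [->|KC] := eqVneq K C; first by exists x; rewrite ?set_trueE.
  have [k] := fM K KF KC; rewrite /resolve_main.
  case: ifP => cxK kK fk; last first.
    exists k => //; apply: set_true_keep => //.
    by apply: contraFneq cxK => <-.
  move: kK; rewrite !inE negb_or => /andP[/andP[kx kcx] /orP[kC|kK]].
    by case/hasP: nC; exists k; rewrite ?kx.
  by exists k => //; apply: set_true_keep.
move=> R /DP_mainP [M [MF MC ->]].
case: (FMU) => _ /(_ _ MF) [f /satisfiesP fM].
exists f; apply/satisfiesP => S; rewrite in_fsetD1 => /andP[SR /DP_mainP [N [NF NC eS]]].
have NM : N != M by apply: contraNneq SR => e; rewrite eS e.
have [|k kN fk] := fM N; first by rewrite !inE NM.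
rewrite eS /resolve_main; case: ifP => cxN; last by exists k.
have [|j jC fj] := fM C; first by rewrite !inE eq_sym MC.
have kx : k != x by apply: contraNneq (notin_main NF NC) => <-.
have jcx : j != compl x by apply: contraNneq cxC => <-.
(* Both parents [N] and [C] are satisfied. The value of [x] decides which of them has a true literal
   outside the resolved pair. *)
have [fx|fx] := boolP (lit_true f x).
  exists k => //; rewrite !inE negb_or kx kN orbT andbT /=.
  by apply: contraTneq fk => ->; rewrite lit_true_compl fx.
exists j => //; rewrite !inE negb_or jcx jC /= !andbT.
by apply: contraNneq fx => <-.
Qed.

Lemma occurs_DP z M D : M \in F -> z \in M -> litvar z != litvar x ->
  D \in F -> compl x \in D -> exists2 R, R \in DP (litvar x) F & z \in R.
Proof.
move=> MF zM zx DF cxD; have [e|MC] := eqVneq M C.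
  exists (resolve_main x C D); first exact/in_DP_main/side_neq_main.
  by rewrite in_resolve_main // cxD -e zM orbT.
exists (resolve_main x C M); first exact: in_DP_main.
by rewrite in_resolve_main // zM.
Qed.

(** When [M] is [C], the literal [z] is copied into every resolvent, so it stays unique only if
    there is a single resolvent; otherwise its occurrence is just carried along. *)
Lemma main_DP z M : main F z M -> litvar z != litvar x ->
  M != C \/ (exists D, main F (compl x) D) ->
  exists R, main (DP (litvar x) F) z R.
Proof.
move=> [MF zM uM] zx; have [eMC|MC] := eqVneq M C; last first.
  move=> _; exists (resolve_main x C M); split; first exact: in_DP_main.
    by rewrite in_resolve_main // zM.
  move=> A /DP_mainP [N [NF NC ->]]; rewrite in_resolve_main //.
  case/orP => [zN|/andP[_ zC]]; first by rewrite (uM N).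
  by case: mainC MC => CF _ _; rewrite (uM C) ?eqxx.
case=> // -[D [DF cxD uD]]; exists (resolve_main x C D); split.
- exact/in_DP_main/side_neq_main.
- by rewrite in_resolve_main // cxD -eMC zM orbT.
- move=> A /DP_mainP [N [NF NC ->]]; rewrite in_resolve_main //.
  case/orP => [zN|/andP[cxN _]]; last by rewrite (uD N).
  by rewrite -eMC (uM N) ?eqxx in NC.
Qed.

(** Were [z] in [C], every resolvent would contain [z] and so equal [R]; injectivity would then
    leave [compl x] a single occurrence. With [z] outside [C], its occurrences before and after
    reduction correspond. *)
Lemma main_DP_inv z R D : main (DP (litvar x) F) z R ->
  D \in F -> compl x \in D -> ldeg F (compl x) != 1%N ->
  [/\ litvar z != litvar x, z \notin C & ldeg F z == 1%N].
Proof.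
move=> [RDP zR uR] DF cxD nu.
have zx : litvar z != litvar x.
  have : litvar z \in varcs (DP (litvar x) F).
    by apply/varcsP; exists R => //; apply/varclP; exists z.
  by move=> /(fsubsetP (varcs_DP _ _)); rewrite !inE => /andP[].
have zC : z \notin C.
  apply: contraNN nu => zC; apply/ldeg1P; exists D; split=> // N NF cxN.
  have u K : K \in F -> compl x \in K -> resolve_main x C K = R.
    move=> KF cxK; apply: uR; first exact/in_DP_main/side_neq_main.
    by rewrite in_resolve_main // cxK zC orbT.
  by apply: resolve_main_inj; rewrite ?side_neq_main // !u.
split=> //; apply/ldeg1P.
have [M [MF MC eR]] := DP_mainP RDP; exists M.
have zM : z \in M by move: zR; rewrite eR in_resolve_main // (negPf zC) andbF orbF.
split=> // N NF zN; have NC : N != C by apply: contraNneq zC => <-.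
apply: resolve_main_inj => //; rewrite -eR; apply: uR; first exact: in_DP_main.
by rewrite in_resolve_main // zN.
Qed.

End Main.

Lemma singular_MU_DP F v : MU F -> singular F v -> MU (DP v F).
Proof. by move=> FMU /singularP [x [C [D [<- mC _ _]]]]; apply: MU_DP mC. Qed.

Lemma singular_varcs F v : singular F v -> v \in varcs F.
Proof.
move=> /singularP [x [C [D [<- [CF xC _] _ _]]]].
by apply/varcsP; exists C => //; apply/varclP; exists x.
Qed.

Lemma card_varcs_DP F v : singular F v -> (#|` varcs (DP v F)| < #|` varcs F|)%N.
Proof.
move=> /singular_varcs vF; apply: fproper_ltn_card.
by apply: fsub_proper_trans (varcs_DP v F) _; apply: fproperD1.
Qed.

(** * Commutation of reductions through subsumption *)

(* Subsumption of [A] in [DP (litvar x) F] is a conjunction over the two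
   literals of the eliminated variable, so for two eliminated variables it is
   symmetric in them; minimally unsatisfiable sets being antichains, [DP] commutes. *)
Definition subsumed (F : clauseset) (A : clause) : Prop :=
  exists2 E, E \in F & E `<=` A.

(** From right to left, either one of the two subsuming clauses avoids the variable and survives, or
    they resolve on [x]; there is no second conflict because [A] has no complementary pair. *)
Lemma subsumed_DP F x A : MU F -> (forall z, z \in A -> compl z \notin A) ->
  litvar x \notin varcl A ->
  subsumed (DP (litvar x) F) A <->
  subsumed F (x |` A) /\ subsumed F (compl x |` A).
Proof.
move=> FMU ntA; rewrite notin_varcl => /andP[xA cxA]; split.
  move=> [E /in_DP [[EF _]|[C [D [CF DF /fsetP e ->]]]] EA].
    by split; exists E => //; apply: fsubset_trans EA (fsubsetUr _ _).
  move: (e x); rewrite !inE eqxx in_complcl => /andP[xC cxD].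
  have cxC := MU_nontaut FMU CF xC.
  have xD := MU_nontaut FMU DF cxD; rewrite complK in xD.
  split; [exists C|exists D] => //; apply/fsubsetP => z zE; rewrite !inE.
    have [//|zx] := eqVneq z x; apply: (fsubsetP EA).
    rewrite !inE negb_or zx zE /= andbT.
    by apply: contraNneq cxC => <-.
  have [//|zx] := eqVneq z (compl x); apply: (fsubsetP EA).
  rewrite !inE negb_or zx zE orbT /= !andbT.
  by apply: contraNneq xD => <-.
move=> [[C CF /fsubsetP CA] [D DF /fsubsetP DA]].
have CA' z : z \in C -> z = x \/ z \in A.
  by move=> /CA; rewrite !inE => /orP[/eqP|]; auto.
have DA' z : z \in D -> z = compl x \/ z \in A.
  by move=> /DA; rewrite !inE => /orP[/eqP|]; auto.
have [xC|xC] := boolP (x \in C); last first.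
  have CsA : C `<=` A.
    by apply/fsubsetP => z zC; case: (CA' z zC) => // e; rewrite e (negPf xC) in zC.
  exists C => //; apply/in_DP; left; split=> //.
  by rewrite notin_varcl xC; apply: contraNN cxA; apply: (fsubsetP CsA).
have [cxD|cxD] := boolP (compl x \in D); last first.
  have DsA : D `<=` A.
    by apply/fsubsetP => z zD; case: (DA' z zD) => // e; rewrite e (negPf cxD) in zD.
  exists D => //; apply/in_DP; left; split=> //.
  by rewrite notin_varcl cxD andbT; apply: contraNN xA; apply: (fsubsetP DsA).
exists ((C `|` D) `\` [fset x; compl x]).
  apply/in_DP; right; exists C, D; split=> //; apply/fsetP => z.
  rewrite !inE in_complcl; apply/andP/eqP => [[zC czD]|->] //.
  case: (CA' z zC) => // zA; case: (DA' _ czD) => [/(inv_inj complK)//|czA].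
  by move: (ntA _ zA); rewrite czA.
apply/fsubsetP => z; rewrite !inE negb_or => /andP[/andP[zx zcx] /orP[/CA'|/DA']].
  by case=> // e; rewrite e eqxx in zx.
by case=> // e; rewrite e eqxx in zcx.
Qed.

Lemma subsumed_DP_DP F v w A : v <> w -> MU F -> MU (DP v F) ->
  (forall z, z \in A -> compl z \notin A) ->
  v \notin varcl A -> w \notin varcl A ->
  subsumed (DP w (DP v F)) A <->
  forall b c, subsumed F ((v, b) |` ((w, c) |` A)).
Proof.
move=> vw FMU DMU ntA vA wA.
have ntwA c z : z \in (w, c) |` A -> compl z \notin (w, c) |` A.
  move: wA; rewrite -[w]/(litvar (w, c)) notin_varcl => /andP[h1 h2].
  rewrite !inE negb_or => /orP[/eqP ->|zA].
    by rewrite compl_neq.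
  rewrite ntA // andbT; apply: contraNneq h2 => <-.
  by rewrite complK.
have vwA c : v \notin varcl ((w, c) |` A).
  apply/varclP => -[z]; rewrite !inE => /orP[/eqP -> /esym//|zA zv].
  by case/varclP: vA; exists z.
have stepv c := @subsumed_DP F (v, true) _ FMU (ntwA c) (vwA c).
have stepw := @subsumed_DP (DP v F) (w, true) A DMU ntA wA.
split.
  move=> /stepw [/stepv [h1 h2] /stepv [h3 h4]] [] [] //.
move=> h; apply/stepw; split; apply/stepv; split; exact: h.
Qed.

Lemma DP_DP_subsumed F v w A : v <> w -> MU F -> MU (DP v F) -> MU (DP w F) ->
  MU (DP w (DP v F)) -> A \in DP w (DP v F) -> subsumed (DP v (DP w F)) A.
Proof.
move=> vw FMU vMU wMU vwMU AX.
have vars n : n \in varcl A -> n \in varcs F `\ v `\ w.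
  move=> nA; have : n \in varcs (DP w (DP v F)) by apply/varcsP; exists A.
  move=> /(fsubsetP (varcs_DP _ _)); rewrite !inE => /andP[-> /=].
  by move=> /(fsubsetP (varcs_DP _ _)); rewrite !inE.
have vA : v \notin varcl A by apply/negP => /vars; rewrite !inE eqxx andbF.
have wA : w \notin varcl A by apply/negP => /vars; rewrite !inE eqxx.
have ntA z : z \in A -> compl z \notin A by apply: (MU_nontaut vwMU).
have wv : w <> v by move=> e; apply: vw.
apply/(subsumed_DP_DP wv) => // b c; rewrite fsetUCA.
have AS : subsumed (DP w (DP v F)) A by exists A; rewrite ?fsubset_refl.
by move/(subsumed_DP_DP vw FMU vMU ntA vA wA): AS; apply.
Qed.

(** Subsuming twice leads from [A] down to some [B] in [G] and then to some [A'] in [F]; the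
    antichain property gives [A' = A], which squeezes [B]. *)
Lemma MU_subsumed_sub F G : MU F -> (forall A, A \in F -> subsumed G A) ->
  (forall B, B \in G -> subsumed F B) -> F `<=` G.
Proof.
move=> FMU FG GF; apply/fsubsetP => A AF.
have [B BG BA] := FG _ AF; have [A' A'F A'B] := GF _ BG.
have e := MU_antichain FMU A'F AF (fsubset_trans A'B BA).
suff -> : A = B by [].
by apply/eqP; rewrite eqEfsubset BA -e A'B.
Qed.

Lemma DP_comm F v w : v <> w -> MU F ->
  MU (DP v F) -> MU (DP w F) -> MU (DP w (DP v F)) -> MU (DP v (DP w F)) ->
  DP w (DP v F) = DP v (DP w F).
Proof.
move=> vw FMU vMU wMU vwMU wvMU; have wv : w <> v by move=> e; apply: vw.
have h1 A := @DP_DP_subsumed F v w A vw FMU vMU wMU vwMU.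
have h2 A := @DP_DP_subsumed F w v A wv FMU wMU vMU wvMU.
by apply/eqP; rewrite eqEfsubset !MU_subsumed_sub.
Qed.

(** * Clashes between singular variables *)

(** The degree conditions fix the signs: [x] and [y] are the only literals over [v] and [w] that
    occur exactly once. *)
Definition clash (F : clauseset) (v w : nat) : Prop :=
  exists x y C, [/\ litvar x = v, litvar y = w, main F x C & main F y C] /\
    ldeg F (compl x) != 1%N /\ ldeg F (compl y) != 1%N.

Lemma clashC F v w : clash F v w -> clash F w v.
Proof. by move=> [x [y [C [[? ? ? ?] [? ?]]]]]; exists y, x, C. Qed.

Lemma singular_DP F v w : MU F -> v <> w -> singular F v -> singular F w ->
  singular (DP v F) w \/ clash F v w.
Proof.
move=> FMU vw /singularP [x [C [D [xv mC DF cxD]]]].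
move=> /singularP [y [M [E [yw mM EF cyE]]]].
have yx : litvar y != litvar x by apply/eqP; rewrite xv yw => e; apply: vw.
have keep z K L : litvar z = w -> main F z K -> L \in F -> compl z \in L ->
    K != C \/ (exists D, main F (compl x) D) -> singular (DP v F) w.
  move=> zw mK LF czL h; apply/singularP.
  have zx : litvar z != litvar x by rewrite zw -yw.
  have [R mR] := main_DP FMU mC mK zx h.
  have [S SF czS] := occurs_DP FMU mC LF czL zx DF cxD.
  by rewrite -xv; exists z, R, S.
have [/ldeg1P u|nx] := boolP (ldeg F (compl x) == 1%N).
  by left; apply: (keep y M E) => //; right.
have [eMC|MC] := eqVneq M C; last by left; apply: (keep y M E) => //; left.
rewrite eMC in mM; have [CF yC _] := mM.
(* If [compl y] also occurs once, it can replace [y]: its clause is not [C], which contains [y]. *)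
have [/ldeg1P [K mK]|ny] := boolP (ldeg F (compl y) == 1%N).
  left; apply: (keep (compl y) K C) => //; rewrite ?complK //; left.
  case: mK => _ cyK _.
  by apply: contraNneq (MU_nontaut FMU CF yC) => <-.
by right; exists x, y, C.
Qed.

Lemma singular_DP2 F v w : MU F -> v <> w -> singular F v -> singular F w ->
  (singular (DP v F) w /\ singular (DP w F) v) \/ clash F v w.
Proof.
move=> FMU vw vs ws; have wv := not_eq_sym vw.
have [wvs|] := singular_DP FMU vw vs ws; last by right.
by have [vws|/clashC] := singular_DP FMU wv ws vs; [left|right].
Qed.

(* In a clash, a variable still singular after one of the two reductions can
   serve as an intermediary commuting with both clashing variables. *)
Lemma clash_intermediate F v w u : MU F -> clash F v w -> singular F v ->
  singular (DP v F) u ->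
  [/\ singular F u, u <> v /\ u <> w, ~ clash F u v & ~ clash F u w].
Proof.
move=> FMU [x [y [C [[xv yw mx my] [nx ny]]]]] /singularP.
move=> [x' [C' [D [x'v mx' DF cxD]]]] /singularP [z [R [S [zu mR SF czS]]]].
have [CF xC uC] := mx.
have ex : x' = x.
  case: (litvar_eq (etrans x'v (esym xv))) => // e.
  by case/negP: nx; rewrite -e; apply/ldeg1P; exists C'.
rewrite ex in cxD; rewrite -xv in mR SF.
have [zx zC /ldeg1P [M mM]] := main_DP_inv FMU mx mR DF cxD nx.
have zsing : singular F u.
  have [N [NF _ eS]] := DP_mainP FMU mx SF; apply/singularP.
  move: czS; rewrite eS in_resolve_main //.
  case/orP => [czN|/andP[_ czC]]; first by exists z, M, N.
  by exists z, M, C.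
(* A clash of [u] with [v] or [w] must use the literal [z] and the clause [C], but [z] is not in
   [C]. *)
have noclash t : (exists y0, [/\ litvar y0 = t, main F y0 C & ldeg F (compl y0) != 1%N]) ->
    u <> t /\ ~ clash F u t.
  move=> [y0 [y0t [_ y0C uy0] ny0]]; split.
    move=> ut; case: (@litvar_eq z y0); first by rewrite zu y0t.
      by move=> e; rewrite e y0C in zC.
    by move=> e; case/negP: ny0; rewrite -e; apply/ldeg1P; exists M.
  move=> [z1 [y1 [C1 [[z1u y1t mz1 my1] [nz1 ny1]]]]].
  have ey : y1 = y0.
    case: (@litvar_eq y1 y0); rewrite ?y1t ?y0t // => e.
    by case/negP: ny0; rewrite -e; apply/ldeg1P; exists C1.
  have ez : z1 = z.
    case: (@litvar_eq z1 z); rewrite ?z1u ?zu // => e.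
    by case/negP: nz1; rewrite e complK; apply/ldeg1P; exists M.
  case: mz1 my1 => C1F z1C1 _ [_ y1C1 _].
  have eC : C1 = C by apply: uy0 => //; rewrite -ey.
  by rewrite -eC -ez z1C1 in zC.
have [|uv nuv] := noclash v; first by exists x.
have [|uw nuw] := noclash w; first by exists y.
by split.
Qed.

(** * Isomorphism is an equivalence relation *)

Lemma imfset_imfset (K : choiceType) (h g : K -> K) (A : {fset K}) :
  h @` (g @` A) = (h \o g) @` A.
Proof.
apply/fsetP => x; apply/imfsetP/imfsetP => /= [[y /imfsetP [z /= zA ->] ->]|[z zA ->]].
  by exists z.
by exists (g z) => //; apply/imfsetP; exists z.
Qed.

Lemma image_clauses_comp (g h : lit -> lit) (F : clauseset) :
  (fun C : clause => h @` C) @` ((fun C : clause => g @` C) @` F) =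
  (fun C : clause => (h \o g) @` C) @` F.
Proof.
rewrite imfset_imfset; apply: eq_imfset => // C /=.
exact: imfset_imfset.
Qed.

Lemma image_clauses_id (g : lit -> lit) (F : clauseset) :
  g =1 id -> (fun C : clause => g @` C) @` F = F.
Proof.
move=> gid; have im C : g @` C = C :> clause.
  apply/fsetP => x; apply/imfsetP/idP => /= [[y yC ->]|xC]; rewrite ?gid //.
  by exists x; rewrite ?gid.
apply/fsetP => C; apply/imfsetP/idP => /= [[D DF ->]|CF]; rewrite ?im //.
by exists C; rewrite ?im.
Qed.

Lemma isomorphic_refl F : isomorphic F F.
Proof.
by exists id; split; [exists id|split=> //; apply: image_clauses_id].
Qed.

Lemma isomorphic_sym F G : isomorphic F G -> isomorphic G F.
Proof.
move=> [g [[h gK hK] [gc <-]]]; exists h; split; first by exists g.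
split; first by move=> x; apply: (can_inj gK); rewrite gc !hK.
by rewrite image_clauses_comp; apply: image_clauses_id.
Qed.

Lemma isomorphic_trans F G H : isomorphic F G -> isomorphic G H -> isomorphic F H.
Proof.
move=> [g [gb [gc <-]]] [h [hb [hc <-]]]; exists (h \o g).
split; first exact: bij_comp.
by split=> [x|] /=; rewrite ?gc ?hc // image_clauses_comp.
Qed.

(** * Clashes under saturation *)

(* The clauses of [DP (litvar y) F] containing [x] are resolvents with [C], so
   they already contain [z]; flipping [x] would therefore turn a satisfying
   assignment of the saturation witness into one of [DP (litvar y) F]. *)
Lemma saturated_main_sub F x y C D E z : MU F -> main F x C -> main F y C ->
  litvar x != litvar y -> saturated (DP (litvar y) F) ->
  D \in F -> compl x \in D -> E \in F -> compl y \in E ->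
  z \in C -> z != x -> z != y -> z \in D.
Proof.
move=> FMU mx my xy [DMU Dsat] DF cxD EF cyE zC zx zy.
have [CF xC uxC] := mx; have [_ yC _] := my.
have ntC := MU_nontaut FMU CF.
have zyv : litvar z != litvar y.
  by apply/eqP => /litvar_eq [] e; rewrite e ?eqxx // in zy zC; move: (ntC _ yC); rewrite zC.
have yx : y != x by apply: contraNneq xy => ->.
(* Hence [D] survives the reduction at [y] unchanged, and saturation can be applied to it. *)
have cyD : compl y \notin D.
  by apply: contraNN yx => cyD; apply/eqP/(main_conflict FMU mx DF).
have eD : resolve_main y C D = D by rewrite /resolve_main (negPf cyD).
have DDP : D \in DP (litvar y) F.
  by rewrite -[D in D \in _]eD; apply: in_DP_main => //; apply: (side_neq_main FMU mx cxD).
apply/negPn/negP => zD.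
have czD : compl z \notin D.
  by apply: contraNN zx => czD; apply/eqP/(main_conflict FMU mx DF).
have zvars : litvar z \in varcs (DP (litvar y) F).
  have [R RF zR] := occurs_DP FMU my CF zC zyv EF cyE.
  by apply/varcsP; exists R => //; apply/varclP; exists z.
have [|f /satisfiesP fs] := Dsat D z DDP zvars; first by rewrite notin_varcl zD.
have fS S : S \in DP (litvar y) F -> S != D -> exists2 k, k \in S & lit_true f k.
  by move=> SF SD; apply: fs; rewrite in_fsetU in_fsetD1 SD SF.
have [k] : exists2 k, k \in D `|` [fset z] & lit_true f k.
  by apply: fs; rewrite in_fsetU !in_fset1 eqxx orbT.
have [unsat _] := DMU.
(* Since [f] satisfies all other clauses of the unsatisfiable reduct, it falsifies [D]; the enlarged
   clause can then only be satisfied through [z]. *)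
have nD k' : k' \in D -> ~~ lit_true f k'.
  move=> k'D; apply/negP => fk'; apply: unsat; exists f; apply/satisfiesP => S SF.
  by have [->|] := eqVneq S D; [exists k'|apply: fS].
rewrite in_fsetU in_fset1 => /orP[/nD /negP //|/eqP -> fz].
case: unsat; exists (set_true f (compl x)); apply/satisfiesP => S SF.
have [->|SD] := eqVneq S D; first by exists (compl x); rewrite ?set_trueE.
have [xS|xS] := boolP (x \in S).
  exists z; last by apply: set_true_keep => //; rewrite complK.
  have [M [MF MC eS]] := DP_mainP FMU my SF.
  move: xS; rewrite eS !in_resolve_main //.
  case/orP => [xM|/andP[-> _]]; last by rewrite zC orbT.
  by rewrite (uxC M) ?eqxx in MC.
have [j jS fj] := fS S SF SD; exists j => //; apply: set_true_keep => //.
by rewrite complK; apply: contraNneq xS => <-.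
Qed.

(** The sign is crossed because, in a clash, [y] enters the reduct at [x] exactly in the images of
    the clauses with [compl x], and these clauses keep [compl x] in the reduct at [y]. *)
Definition swap_lits (x y : lit) (z : lit) : lit :=
  if z == y then compl x else if z == compl y then x
  else if z == x then compl y else if z == compl x then y else z.

Lemma compl_eq x y : (compl x == compl y) = (x == y).
Proof. exact: (inj_eq (inv_inj complK)). Qed.

Lemma compl_eqr x y : (compl x == y) = (x == compl y).
Proof. by rewrite -(compl_eq x) complK. Qed.

Section Swap.
Variables x y : lit.
Hypothesis xy : litvar x != litvar y.

Let neqs : [/\ x != y, x != compl y, compl x != y & compl x != compl y].
Proof. by split; apply: contraNneq xy => e; rewrite -?(litvar_compl x) e. Qed.

Lemma swap_lits_compl z : swap_lits x y (compl z) = compl (swap_lits x y z).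
Proof.
rewrite /swap_lits !compl_eqr !complK.
have [n1 n2 n3 n4] := neqs.
have [->|zy] := eqVneq z y; first by rewrite eq_sym (negPf (compl_neq y)) complK.
have [e|zcy] := eqVneq z (compl y); first by [].
have [->|zx] := eqVneq z x; first by rewrite eq_sym (negPf (compl_neq x)) complK.
by case: ifP.
Qed.

Lemma swap_litsK : involutive (swap_lits x y).
Proof.
have [n1 n2 n3 n4] := neqs.
move=> z; rewrite {2}/swap_lits.
have [->|zy] := eqVneq z y.
  by rewrite /swap_lits (negPf n3) (negPf n4) (negPf (compl_neq x)) eqxx.
have [->|zcy] := eqVneq z (compl y).
  by rewrite /swap_lits (negPf n1) (negPf n2) eqxx.
have [->|zx] := eqVneq z x.
  by rewrite /swap_lits (negPf (compl_neq y)) eqxx.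
have [->|zcx] := eqVneq z (compl x); first by rewrite /swap_lits eqxx.
by rewrite /swap_lits (negPf zy) (negPf zcy) (negPf zx) (negPf zcx).
Qed.

Lemma in_image_swap z (A : clause) :
  (z \in swap_lits x y @` A) = (swap_lits x y z \in A).
Proof.
apply/imfsetP/idP => /= [[t tA ->]|zA]; first by rewrite swap_litsK.
by exists (swap_lits x y z); rewrite ?swap_litsK.
Qed.

End Swap.

Lemma clash_isomorphic F v w : MU F -> clash F v w -> v <> w ->
  singular F v -> singular F w -> saturated (DP v F) -> saturated (DP w F) ->
  isomorphic (DP v F) (DP w F).
Proof.
move=> FMU [x [y [C [[xv yw mx my] [nx ny]]]]] vw.
(* [clash] alone does not provide occurrences of the complements; singularity does, once the degree
   condition has fixed the sign. *)
have side t z : litvar z = t -> ldeg F (compl z) != 1%N -> singular F t ->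
    exists2 E, E \in F & compl z \in E.
  move=> zt nz /singularP [z' [C' [E [z't mz' EF czE]]]].
  case: (litvar_eq (etrans z't (esym zt))) => e; first by exists E; rewrite -?e.
  by case/negP: nz; rewrite -e; apply/ldeg1P; exists C'.
move=> /(side _ _ xv nx) [D0 D0F cxD0] /(side _ _ yw ny) [E0 E0F cyE0].
have xy : litvar x != litvar y by rewrite xv yw; apply/eqP.
have yx : litvar y != litvar x by rewrite eq_sym.
rewrite -xv -yw => satx saty.
have subD D z : D \in F -> compl x \in D -> z \in C -> z != x -> z != y -> z \in D.
  by move=> DF cxD; apply: (saturated_main_sub FMU mx my xy saty DF cxD E0F).
have subE E z : E \in F -> compl y \in E -> z \in C -> z != y -> z != x -> z \in E.
  by move=> EF cyE; apply: (saturated_main_sub FMU my mx yx satx EF cyE D0F).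
pose g := swap_lits x y.
have gK : involutive g by apply: swap_litsK.
exists g; split; first by exists g.
split; first exact: swap_lits_compl.
have [n1 n2 n3 n4] : [/\ x != y, x != compl y, compl x != y & compl x != compl y].
  by split; apply: contraNneq xy => e; rewrite -?(litvar_compl x) e.
have [CF xC _] := mx; have [_ yC _] := my.
have cxC := MU_nontaut FMU CF xC; have cyC := MU_nontaut FMU CF yC.
(* If [compl x] is in [M], saturation puts all of [C] but [x] and [y] into [M], so resolving at [x]
   merely replaces [compl x] by [y], and [g] undoes this. The case of [compl y] is dual; any other
   [M] is fixed. *)
have gres M : M \in F `\ C -> g @` resolve_main x C M = resolve_main y C M.
  rewrite in_fsetD1 => /andP[MC MF]; apply/fsetP => z.
  have xM := notin_main mx MF MC; have yM := notin_main my MF MC.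
  have ncxy : compl x \in M -> compl y \notin M.
    move=> cxM; apply: contraNN n1 => cyM; apply/eqP.
    by apply/esym/(main_conflict FMU mx MF cxM yC cyM).
  have subC t : (compl x \in M) || (compl y \in M) -> t \in C -> t != x -> t != y -> t \in M.
    by case/orP => c tC tx ty; [apply: subD|apply: subE].
  rewrite in_image_swap // /g /swap_lits /resolve_main.
  have [cxM|cxM] := boolP (compl x \in M).
    have cyM := ncxy cxM; rewrite (negPf cyM).
    have [->|zy] := eqVneq z y; first by rewrite !inE eqxx orbT (negPf yM).
    have [->|zcy] := eqVneq z (compl y); first by rewrite !inE eqxx (negPf cyM).
    have [->|zx] := eqVneq z x.
      by rewrite !inE (negPf cyC) (negPf cyM) (negPf xM) !andbF.
    have [->|zcx] := eqVneq z (compl x).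
      by rewrite !inE yC eq_sym (negPf n1) eq_sym (negPf n3) cxM.
    rewrite !inE (negPf zx) (negPf zcx) /=; apply/orP/idP => [[zC|//]|]; last by right.
    by apply: subC; rewrite ?cxM.
  have [cyM|cyM] := boolP (compl y \in M).
    have [->|zy] := eqVneq z y; first by rewrite !inE eqxx (negPf cxM).
    have [->|zcy] := eqVneq z (compl y); first by rewrite !inE eqxx orbT (negPf xM).
    have [->|zx] := eqVneq z x.
      by rewrite !inE cyM (negPf n1) (negPf n2) xC.
    have [->|zcx] := eqVneq z (compl x).
      by rewrite !inE (negPf yM) (negPf cxC) (negPf cxM) !andbF.
    rewrite !inE (negPf zy) (negPf zcy) /=; apply/idP/orP => [|[zC|//]]; first by right.
    by apply: subC; rewrite ?cyM ?orbT.
  have [->|zy] := eqVneq z y; first by rewrite (negPf yM) (negPf cxM).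
  have [->|zcy] := eqVneq z (compl y); first by rewrite (negPf xM) (negPf cyM).
  have [->|zx] := eqVneq z x; first by rewrite (negPf xM) (negPf cyM).
  by have [->|zcx] := eqVneq z (compl x); first by rewrite (negPf yM) (negPf cxM).
rewrite (DP_main FMU mx) (DP_main FMU my).
apply/fsetP => A; apply/imfsetP/imfsetP => /=.
  by move=> [_ /imfsetP [M /= MFC ->] ->]; exists M => //; apply: gres.
move=> [M MFC ->]; exists (resolve_main x C M); last by rewrite gres.
by apply/imfsetP; exists M.
Qed.

(** * Existence of nonsingular reducts and the confluence induction *)

Lemma singular_or_nonsingular F : nonsingular F \/ exists v, singular F v.
Proof.
have [/hasP /= [v _ /eqP vsing]|nosing] :=
    boolP (has (fun v => minn (ldeg F (posl v)) (ldeg F (negl v)) == 1%N) (varcs F)).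
  by right; exists v.
left=> v vsing; case/hasP: nosing; exists v; last exact/eqP.
exact: singular_varcs.
Qed.

Lemma sDP_exists F : MU F -> exists F', in_sDP F F'.
Proof.
have [n] := ubnP #|` varcs F|; elim: n => // n IH in F * => Fn FMU.
have [ns|[v vs]] := singular_or_nonsingular F.
  by exists F; split; first exact: sDP_refl.
have [|F' [star h]] := IH (DP v F) _ (singular_MU_DP FMU vs).
  exact: leq_trans (card_varcs_DP vs) Fn.
exists F'; split=> //; apply: sDP_cons star.
by split=> //; exists v.
Qed.

Lemma in_sDP_step F v F' : MU F -> singular F v -> in_sDP (DP v F) F' -> in_sDP F F'.
Proof.
move=> FMU vs [star h]; split=> //; apply: sDP_cons star.
by split=> //; exists v.
Qed.

Lemma in_sDPP F F' : in_sDP F F' ->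
  (F' = F /\ nonsingular F) \/ exists2 v, singular F v & in_sDP (DP v F) F'.
Proof.
move=> [star [ns FMU]]; case: star ns FMU => [G|G H K [GMU [v [vs ->]]] star] ns KMU.
  by left.
by right; exists v.
Qed.

Lemma in_sDP_nonsingular F F' : in_sDP F F' -> nonsingular F -> F' = F.
Proof. by move=> /in_sDPP [[-> //]|[v vs _]] /(_ v). Qed.

Lemma eventually_saturated_isomorphic F : MU F ->
  (forall F', in_sDP F F' -> saturated F') ->
  forall F' F'', in_sDP F F' -> in_sDP F F'' -> isomorphic F' F''.
Proof.
have [n] := ubnP #|` varcs F|; elim: n => // n IHn in F * => Fn FMU satF.
have IH v : singular F v -> forall F' F'',
    in_sDP (DP v F) F' -> in_sDP (DP v F) F'' -> isomorphic F' F''.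
  move=> vs; apply: IHn.
  - exact: leq_trans (card_varcs_DP vs) Fn.
  - exact: singular_MU_DP.
  - by move=> F' h; apply: satF; apply: in_sDP_step h.
have join v w F' F'' : v <> w -> singular F v -> singular F w ->
    singular (DP v F) w -> singular (DP w F) v ->
    in_sDP (DP v F) F' -> in_sDP (DP w F) F'' -> isomorphic F' F''.
  move=> vw vs ws wvs vws vF' wF''.
  have vMU := singular_MU_DP FMU vs; have wMU := singular_MU_DP FMU ws.
  have vwMU := singular_MU_DP vMU wvs; have wvMU := singular_MU_DP wMU vws.
  (* The reductions close a diamond; a nonsingular reduct [H] of its common end is reachable through
     [v] and through [w], so the induction hypothesis applies on both sides. *)
  have comm := DP_comm vw FMU vMU wMU vwMU wvMU.
  have [H hH] := sDP_exists vwMU.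
  apply: (@isomorphic_trans _ H).
    by apply: (IH v vs) => //; apply: in_sDP_step hH.
  apply: (IH w ws) => //; rewrite comm in hH; exact: in_sDP_step hH.
have third v w u F' F'' : v <> w -> singular F v -> singular F w ->
    clash F v w -> singular (DP v F) u ->
    in_sDP (DP v F) F' -> in_sDP (DP w F) F'' -> isomorphic F' F''.
  move=> vw vs ws cl us vF' wF''.
  (* The clash is bypassed through [u]: a nonsingular reduct [H] of [DP u F] is joined with each
     side by the diamond argument. *)
  have [us' [uv uw] nuv nuw] := clash_intermediate FMU cl vs us.
  have [H hH] := sDP_exists (singular_MU_DP FMU us').
  have [[vus uvs]|//] := singular_DP2 FMU uv us' vs.
  have [[wus uws]|//] := singular_DP2 FMU uw us' ws.
  apply: (@isomorphic_trans _ H).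
    by apply/isomorphic_sym/(join u v).
  by apply: (join u w).
move=> F' F'' hF' hF''.
case: (in_sDPP hF') => [[-> ns]|[v vs vF']].
  by rewrite (in_sDP_nonsingular hF'' ns); apply: isomorphic_refl.
case: (in_sDPP hF'') => [[-> ns]|[w ws wF'']]; first by case: (ns v).
have [evw|/eqP vw] := eqVneq v w; first by apply: (IH v) => //; rewrite evw.
have [[wvs vws]|cl] := singular_DP2 FMU vw vs ws.
  exact: (join v w).
have [vns|[u us]] := singular_or_nonsingular (DP v F); last exact: (third v w u).
have [wns|[u us]] := singular_or_nonsingular (DP w F); last first.
  apply/isomorphic_sym/(third w v u) => //; first exact: not_eq_sym.
  exact: clashC.
(* No further reduction is possible, so [F'] and [F''] are the two reducts themselves and are
   saturated by hypothesis. *)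
have eF' := in_sDP_nonsingular vF' vns; have eF'' := in_sDP_nonsingular wF'' wns.
rewrite eF' eF'' in hF' hF'' *.
by apply: clash_isomorphic => //; apply: satF.
Qed.

Theorem theorem71 (F : clauseset) :
  is_clauseset F -> MU F ->
  (forall F', in_sDP F F' -> saturated F') ->
  forall F' F'', in_sDP F F' -> in_sDP F F'' -> isomorphic F' F''.
Proof. by move=> _; apply: eventually_saturated_isomorphic. Qed.
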